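(* Let $A\in\mathbb{R}^{n\times n}$ be the weighted adjacency matrix of a strongly connected digraph on $\{1,\dots,n\}$, let $\mathcal{P}=\{\mathcal{P}_1,\dots,\mathcal{P}_m\}$, $m>1$, be a partition of $\{1,\dots,n\}$, and let $V_{\mathcal{P}}$, $\bar V_{\mathcal{P}}$, $\bar A$, $\mathcal{H}$ and $H$ be as defined in the context. Consider the minimization problem $$\min_{\Delta\in\mathbb{R}^{n\times n}}\ \|\Delta\|_F^2\quad\text{subject to}\quad \bar V_{\mathcal{P}}^{\mathsf T}\,[\bar A+\Delta]\,V_{\mathcal{P}}=0,\quad \Delta\in\mathcal{H}.\qquad(\ast)$$ Let $T=[V_{\mathcal{P}}\ \ \bar V_{\mathcal{P}}]$ and let $$\begin{bmatrix}\tilde A_{11}&\tilde A_{12}\\ \tilde A_{21}&\tilde A_{22}\end{bmatrix}=T^{-1}\bar A\,T,$$ where $\tilde A_{11}\in\mathbb{R}^{m\times m}$ and $\tilde A_{22}\in\mathbb{R}^{(n-m)\times(n-m)}$. Then problem $(\ast)$ has a solution if and only if there exists a matrix $\Lambda\in\mathbb{R}^{(n-m)\times m}$ satisfying $$X=(\bar V_{\mathcal{P}}\,\Lambda\, V_{\mathcal{P}}^{\mathsf T})\odot H\qquad\text{and}\qquad \tilde A_{21}=\bar V_{\mathcal{P}}^{\mathsf T}\,X\,V_{\mathcal{P}}$$ (the first equality defining $X$ in terms of $\Lambda$). Moreover, if it exists, a solution $\Delta^*$ to $(\ast)$ is $$\Delta^*=T\begin{bmatrix}\tilde\Delta_{11}^*&\tilde\Delta_{12}^*\\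 \tilde\Delta_{21}^*&\tilde\Delta_{22}^*\end{bmatrix}T^{-1},$$ where $\tilde\Delta_{11}^*=-V_{\mathcal{P}}^{\mathsf T}XV_{\mathcal{P}}$, $\tilde\Delta_{12}^*=-V_{\mathcal{P}}^{\mathsf T}X\bar V_{\mathcal{P}}$, $\tilde\Delta_{21}^*=-\tilde A_{21}$, and $\tilde\Delta_{22}^*=-\bar V_{\mathcal{P}}^{\mathsf T}X\bar V_{\mathcal{P}}$.
   Context: The weighted adjacency matrix $A=[a_{ij}]$ of a digraph with edge set $\mathcal{E}$ has $a_{ij}\in\mathbb{R}$ if $(i,j)\in\mathcal{E}$ and $a_{ij}=0$ otherwise. A partition has nonempty, pairwise disjoint members with union $\{1,\dots,n\}$; nodes are labeled so that $\mathcal{P}_1,\dots,\mathcal{P}_m$ are consecutive blocks of indices. $\odot$ denotes the Hadamard (entrywise) product and $\|\cdot\|_F$ the Frobenius norm. The characteristic matrix $V_{\mathcal{P}}\in\mathbb{R}^{n\times m}$ has as $i$-th column the indicator vector of $\mathcal{P}_i$, here normalized to unit Euclidean length (i.e. entries $1/\sqrt{|\mathcal{P}_i|}$ on $\mathcal{P}_i$ and $0$ elsewhere), so that $V_{\mathcal{P}}^{\mathsf T}V_{\mathcal{P}}=I_m$. The matrix $\bar V_{\mathcal{P}}\in\mathbb{R}^{n\times(n-m)}$ has orthonormal columns spanning the orthogonal complement of the image of $V_{\mathcal{P}}$: $\bar V_{\mathcal{P}}^{\mathsf T}\bar V_{\mathcal{P}}=I_{n-m}$ and $\bar V_{\mathcal{P}}^{\mathsf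 T}V_{\mathcal{P}}=0$. The matrix $\bar A=[\bar a_{ij}]$ is $A$ with intra-cluster weights removed: $\bar a_{ij}=a_{ij}$ if $i$ and $j$ belong to different clusters of $\mathcal{P}$, and $\bar a_{ij}=0$ if they belong to the same cluster (equivalently $\bar A=A-A\odot V V^{\mathsf T}$, with $V$ the non-normalized $0/1$ indicator matrix of $\mathcal{P}$). The set $\mathcal{H}\subseteq\mathbb{R}^{n\times n}$ encodes a desired sparsity pattern: for a given set of allowed positions $S\subseteq\{1,\dots,n\}^2$, $\mathcal{H}=\{M\in\mathbb{R}^{n\times n}: m_{ij}=0\text{ if }(i,j)\notin S\}$. The matrix $H=[h_{ij}]$ has $h_{ij}=1$ if there exists $M\in\mathcal{H}$ with $m_{ij}\neq0$, and $h_{ij}=0$ otherwise. *)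

(* Defs.v *)
From HB Require Import structures.
From mathcomp Require Import all_boot all_order all_algebra.
From mathcomp Require Import boolp reals.
Set Implicit Arguments.
Unset Strict Implicit.
Unset Printing Implicit Defensive.
Import Order.TTheory GRing.Theory Num.Theory.
Local Open Scope ring_scope.

Definition strongly_connected (n : nat) (E : rel 'I_n) : Prop :=
  forall i j : 'I_n, connect E i j.

Definition weighted_adjacency (R : realType) (n : nat) (E : rel 'I_n)
    (A : 'M[R]_n) : Prop :=
  forall i j : 'I_n, ~~ E i j -> A i j = 0.

(* Injectivity of the labelling makes {P_1, ..., P_m} have exactly m members;
   library partitions have nonempty members. *)
Definition is_partition (n m : nat) (P : 'I_m -> {set 'I_n}) : Prop :=
  injective P /\ partition [set P a | a : 'I_m] [set: 'I_n].

Definition consecutive_blocks (n m : nat) (P : 'I_m -> {set 'I_n}) : Prop :=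
  forall (a b : 'I_m) (i j : 'I_n),
    (a < b)%N -> i \in P a -> j \in P b -> (i < j)%N.

Definition char_mx (R : realType) (n m : nat) (P : 'I_m -> {set 'I_n}) :
    'M[R]_(n, m) :=
  \matrix_(i < n, a < m)
    (if i \in P a then (Num.sqrt (#|P a|%:R : R))^-1 else 0).

(* When n = m + k and the columns of V are orthonormal, the k columns of such
   a W span the orthogonal complement of the image of V. *)
Definition orthonormal_complement (R : realType) (n m k : nat)
    (V : 'M[R]_(n, m)) (W : 'M[R]_(n, k)) : Prop :=
  W^T *m W = 1%:M /\ W^T *m V = 0.

Definition same_cluster (n m : nat) (P : 'I_m -> {set 'I_n}) (i j : 'I_n) :
    bool :=
  [exists a : 'I_m, (i \in P a) && (j \in P a)].

Definition inter_cluster_mx (R : realType) (n m : nat)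
    (P : 'I_m -> {set 'I_n}) (A : 'M[R]_n) : 'M[R]_n :=
  \matrix_(i < n, j < n) (if same_cluster P i j then 0 else A i j).

Definition hadamard (R : realType) (n m : nat) (A B : 'M[R]_(n, m)) :
    'M[R]_(n, m) :=
  map2_mx *%R A B.

Definition frobenius_norm (R : realType) (n m : nat) (A : 'M[R]_(n, m)) : R :=
  Num.sqrt (\sum_(i < n) \sum_(j < m) A i j ^+ 2).

Definition sparsity_set (R : realType) (n : nat) (S : {set 'I_n * 'I_n})
    (M : 'M[R]_n) : Prop :=
  forall i j : 'I_n, (i, j) \notin S -> M i j = 0.

Definition pattern_mx (R : realType) (n : nat) (calH : 'M[R]_n -> Prop) :
    'M[R]_n :=
  \matrix_(i < n, j < n)
    (if `[< exists M : 'M[R]_n, calH M /\ M i j <> 0 >] then 1 else 0).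

Definition feasible (R : realType) (n m k : nat) (V : 'M[R]_(n, m))
    (W : 'M[R]_(n, k)) (B : 'M[R]_n) (calH : 'M[R]_n -> Prop)
    (D : 'M[R]_n) : Prop :=
  W^T *m (B + D) *m V = 0 /\ calH D.

Definition is_minimizer (R : realType) (n m k : nat) (V : 'M[R]_(n, m))
    (W : 'M[R]_(n, k)) (B : 'M[R]_n) (calH : 'M[R]_n -> Prop)
    (D : 'M[R]_n) : Prop :=
  feasible V W B calH D /\
  forall D' : 'M[R]_n, feasible V W B calH D' ->
    frobenius_norm D ^+ 2 <= frobenius_norm D' ^+ 2.

(* Main.v *)
Require Import Defs.
From HB Require Import structures.
From mathcomp Require Import all_boot all_order all_algebra.
From mathcomp Require Import boolp reals.
Set Implicit Arguments.
Unset Strict Implicit.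
Unset Printing Implicit Defensive.
Import Order.TTheory GRing.Theory Num.Theory.
Local Open Scope ring_scope.

(** Since [T] is square with orthonormal columns, its inverse is its transpose;
    hence the block [A21] is [Vbar^T *m Abar *m V], the constraint reads
    [Vbar^T *m D *m V = - A21], and the matrix proposed as a minimizer is just
    [- X] written in the basis [T].

    Everything then happens in the Euclidean space of matrices with the
    Frobenius inner product.  Let [g D = Vbar^T *m hadamard D H *m V].  Its
    adjoint is [f L = hadamard (Vbar *m L *m V^T) H] ([adjoint_masked]).  A
    matrix with the prescribed sparsity is fixed by masking with [H], so the
    feasible matrices are the sparse solutions of [g D = - A21], and the two
    conditions on [Lambda] and [X] say [X = f Lambda] and [g X = A21].

    - If [X = f Lambda] and [g X = A21], then [- X] is feasible and [X] is
      orthogonal to the kernel of [g], so by Pythagoras [- X] is the element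
      of least norm in the affine space of feasible matrices
      ([least_norm_in_fibre]).
    - Conversely, any feasible matrix shows that [A21] is in the image of [g];
      over a real field the image of [g] is the image of [g \o f]
      ([adjoint_range]), which produces [Lambda]. *)

(** * The Frobenius inner product *)

Definition frobenius_inner (R : realType) (p q : nat) (A B : 'M[R]_(p, q)) : R :=
  \sum_i \sum_j A i j * B i j.

Lemma frobenius_normE (R : realType) (p q : nat) (A : 'M[R]_(p, q)) :
  frobenius_norm A ^+ 2 = frobenius_inner A A.
Proof.
rewrite /frobenius_norm sqr_sqrtr; last first.
  by apply: sumr_ge0 => i _; apply: sumr_ge0 => j _; exact: sqr_ge0.
by apply: eq_bigr => i _; apply: eq_bigr => j _; rewrite expr2.
Qed.

Lemma frobenius_inner_ge0 (R : realType) (p q : nat) (A : 'M[R]_(p, q)) :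
  0 <= frobenius_inner A A.
Proof. by rewrite -frobenius_normE sqr_ge0. Qed.

Lemma frobenius_inner_eq0 (R : realType) (p q : nat) (A : 'M[R]_(p, q)) :
  frobenius_inner A A = 0 -> A = 0.
Proof.
move=> A0; apply/matrixP => i j; rewrite mxE; apply/eqP.
have sq_ge0 (i' : 'I_p) (j' : 'I_q) : 0 <= A i' j' * A i' j'.
  by rewrite -expr2 sqr_ge0.
have row_ge0 (i' : 'I_p) : true -> 0 <= \sum_j A i' j * A i' j.
  by move=> _; apply: sumr_ge0.
have row0 := psumr_eq0P row_ge0 A0 (i := i) isT.
have := psumr_eq0P (fun j' _ => sq_ge0 i j') row0 (i := j) isT.
by move/eqP; rewrite mulf_eq0 orbb.
Qed.

Lemma frobenius_innerC (R : realType) (p q : nat) (A B : 'M[R]_(p, q)) :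
  frobenius_inner A B = frobenius_inner B A.
Proof. by apply: eq_bigr => i _; apply: eq_bigr => j _; rewrite mulrC. Qed.

Lemma frobenius_innerDr (R : realType) (p q : nat) (A B C : 'M[R]_(p, q)) :
  frobenius_inner A (B + C) = frobenius_inner A B + frobenius_inner A C.
Proof.
rewrite -big_split; apply: eq_bigr => i _; rewrite -big_split.
by apply: eq_bigr => j _; rewrite mxE mulrDr.
Qed.

Lemma frobenius_inner0r (R : realType) (p q : nat) (A : 'M[R]_(p, q)) :
  frobenius_inner A 0 = 0.
Proof. by apply: big1 => i _; apply: big1 => j _; rewrite mxE mulr0. Qed.

Lemma frobenius_inner_tr (R : realType) (p q : nat) (A B : 'M[R]_(p, q)) :
  frobenius_inner A B = \tr (A^T *m B).
Proof.
rewrite /frobenius_inner exchange_big; apply: eq_bigr => j _.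
by rewrite mxE; apply: eq_bigr => i _; rewrite mxE.
Qed.

Lemma frobenius_inner_mxvec (R : realType) (p q : nat) (A B : 'M[R]_(p, q)) :
  mxvec A *m (mxvec B)^T = (frobenius_inner A B)%:M.
Proof.
apply/matrixP => i j; rewrite !ord1 !mxE /= mulr1n.
rewrite /frobenius_inner pair_bigA /= (reindex _ (curry_mxvec_bij p q)) /=.
by apply: eq_bigr => -[i' j'] _ /=; rewrite !mxE !mxvecE.
Qed.

Lemma frobenius_inner_mul (R : realType) (p q r s : nat) (W : 'M[R]_(p, r))
    (V : 'M[R]_(q, s)) (L : 'M[R]_(r, s)) (D : 'M[R]_(p, q)) :
  frobenius_inner (W *m L *m V^T) D = frobenius_inner L (W^T *m D *m V).
Proof.
by rewrite !frobenius_inner_tr !trmx_mul trmxK -!mulmxA mxtrace_mulC !mulmxA.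
Qed.

Lemma frobenius_inner_hadamard (R : realType) (p q : nat)
    (A B H : 'M[R]_(p, q)) :
  frobenius_inner (hadamard A H) B = frobenius_inner A (hadamard B H).
Proof.
by apply: eq_bigr => i _; apply: eq_bigr => j _; rewrite !mxE mulrAC mulrA.
Qed.

Lemma adjoint_masked (R : realType) (p q r s : nat) (W : 'M[R]_(p, r))
    (V : 'M[R]_(q, s)) (H : 'M[R]_(p, q)) (L : 'M[R]_(r, s)) (D : 'M[R]_(p, q)) :
  frobenius_inner (hadamard (W *m L *m V^T) H) D =
  frobenius_inner L (W^T *m hadamard D H *m V).
Proof. by rewrite frobenius_inner_hadamard frobenius_inner_mul. Qed.

(** * Adjoint maps *)

(** The row space of [M^T] meets the kernel of [M] only in [0], because
    [v = w *m M^T] and [v *m M = 0] give [v *m v^T = 0]; so [M^T *m M] has the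
    rank of [M]. *)
Lemma submx_gram (R : realType) (p q : nat) (M : 'M[R]_(p, q)) :
  (M <= M^T *m M)%MS.
Proof.
have cap0 : (M^T :&: kermx M)%MS = 0.
  apply/eqP/rowV0P => v; rewrite sub_capmx => /andP[/submxP[w v_w] /sub_kermxP vM].
  have vv : v *m v^T = 0 by rewrite {2}v_w trmx_mul trmxK mulmxA vM mul0mx.
  apply: frobenius_inner_eq0.
  by rewrite frobenius_inner_tr mxtrace_mulC vv mxtrace0.
have := mxrank_mul_ker M^T M; rewrite cap0 mxrank0 addn0 mxrank_tr => rk.
have /mxrank_leqif_sup [_] := submxMl M^T M.
by rewrite rk eqxx => <-.
Qed.

(** In coordinates the adjoint [f] of [g] is the transpose of the matrix of [g],
    and [submx_gram] applies to that matrix. *)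
Lemma adjoint_range (R : realType) (p q r s : nat)
    (g : {linear 'M[R]_(p, q) -> 'M[R]_(r, s)})
    (f : 'M[R]_(r, s) -> 'M[R]_(p, q)) :
  (forall L D, frobenius_inner (f L) D = frobenius_inner L (g D)) ->
  forall D, exists L, g (f L) = g D.
Proof.
move=> adj D; set G := lin_mx g.
have fE L : mxvec (f L) = mxvec L *m G^T.
  rewrite -[RHS]vec_mxK; congr mxvec; set F := vec_mx _.
  (* F and f L have the same inner product with every matrix, in particular
     with their difference. *)
  have adjF B : frobenius_inner F B = frobenius_inner (f L) B.
    have : (frobenius_inner F B)%:M = (frobenius_inner (f L) B)%:M :> 'M[R]_1.
      rewrite adj -!frobenius_inner_mxvec /F vec_mxK -mul_vec_lin.
      by rewrite trmx_mul mulmxA.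
    by move/matrixP/(_ 0 0); rewrite !mxE /= !mulr1n.
  apply/esym/subr0_eq/frobenius_inner_eq0; set B := F - f L.
  apply: (addIr (frobenius_inner B (f L))).
  rewrite add0r -frobenius_innerDr {2}/B subrK.
  by rewrite frobenius_innerC adjF frobenius_innerC.
have /submxP[w wE] := submx_trans (submxMl (mxvec D) G) (submx_gram G).
exists (vec_mx w); apply: (can_inj mxvecK).
by rewrite -!mul_vec_lin fE vec_mxK -mulmxA -wE.
Qed.

(** Pythagoras: [f L] is orthogonal to the kernel of [g], hence to [D - f L]. *)
Lemma least_norm_in_fibre (R : realType) (p q r s : nat)
    (g : {linear 'M[R]_(p, q) -> 'M[R]_(r, s)})
    (f : 'M[R]_(r, s) -> 'M[R]_(p, q)) (L : 'M[R]_(r, s)) (D : 'M[R]_(p, q)) :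
  (forall L D, frobenius_inner (f L) D = frobenius_inner L (g D)) ->
  g D = g (f L) -> frobenius_norm (f L) ^+ 2 <= frobenius_norm D ^+ 2.
Proof.
move=> adj gD; rewrite !frobenius_normE -[D](subrK (f L)).
set Y := f L.
have YK : frobenius_inner Y (D - Y) = 0.
  by rewrite adj linearB /= gD subrr frobenius_inner0r.
move: (D - Y) YK => K YK.
rewrite frobenius_innerDr !(frobenius_innerC (K + Y)) !frobenius_innerDr.
by rewrite (frobenius_innerC K Y) YK addr0 add0r lerDr frobenius_inner_ge0.
Qed.

Definition masked_compression (R : realType) (p q r s : nat)
    (W : 'M[R]_(p, r)) (V : 'M[R]_(q, s)) (H D : 'M[R]_(p, q)) : 'M[R]_(r, s) :=
  W^T *m hadamard D H *m V.

Lemma masked_compression_is_linear (R : realType) (p q r s : nat)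
    (W : 'M[R]_(p, r)) (V : 'M[R]_(q, s)) (H : 'M[R]_(p, q)) :
  linear (masked_compression W V H).
Proof.
move=> a D1 D2; rewrite /masked_compression.
have -> : hadamard (a *: D1 + D2) H = a *: hadamard D1 H + hadamard D2 H.
  by apply/matrixP => i j; rewrite !mxE mulrDl mulrA.
by rewrite mulmxDr mulmxDl -scalemxAr -scalemxAl.
Qed.

HB.instance Definition _ (R : realType) (p q r s : nat) (W : 'M[R]_(p, r))
    (V : 'M[R]_(q, s)) (H : 'M[R]_(p, q)) :=
  GRing.isLinear.Build R 'M[R]_(p, q) 'M[R]_(r, s) _ (masked_compression W V H)
    (masked_compression_is_linear W V H).

(** * Sparsity patterns *)

Lemma pattern_mxE (R : realType) (n : nat) (S : {set 'I_n * 'I_n})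
    (i j : 'I_n) :
  pattern_mx (@sparsity_set R n S) i j = ((i, j) \in S)%:R.
Proof.
rewrite mxE; case: ifPn => [/asboolP[M [SM Mij]]|/asboolPn noM].
  by case: (boolP ((i, j) \in S)) => // /SM.
case: (boolP ((i, j) \in S)) => // ijS; case: noM.
exists (delta_mx i j); split; last by rewrite mxE !eqxx; apply/eqP/oner_neq0.
move=> i' j' i'j'S; rewrite mxE.
by case: eqP => //= ei; case: eqP => //= ej; rewrite ei ej ijS in i'j'S.
Qed.

Lemma sparse_hadamard (R : realType) (n : nat) (S : {set 'I_n * 'I_n})
    (M : 'M[R]_n) :
  sparsity_set S M -> hadamard M (pattern_mx (@sparsity_set R n S)) = M.
Proof.
move=> SM; apply/matrixP => i j; rewrite mxE pattern_mxE.
by case: (boolP ((i, j) \in S)) => [|/SM ->]; rewrite ?mulr1 ?mul0r.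
Qed.

Lemma hadamard_sparse (R : realType) (n : nat) (S : {set 'I_n * 'I_n})
    (M : 'M[R]_n) :
  sparsity_set S (hadamard M (pattern_mx (@sparsity_set R n S))).
Proof. by move=> i j ijS; rewrite mxE pattern_mxE (negbTE ijS) mulr0. Qed.

(** * Orthonormal bases *)

Lemma char_mx_orthonormal (R : realType) (n m : nat) (P : 'I_m -> {set 'I_n}) :
  is_partition P -> (char_mx R P)^T *m char_mx R P = 1%:M.
Proof.
move=> [injP /and3P[_ /trivIsetP triv nonempty]].
apply/matrixP => a b; rewrite !mxE.
case: (eqVneq a b) => [<-|neq_ab]; last first.
  have dis : [disjoint P a & P b].
    by apply: triv; rewrite ?imset_f // (inj_eq injP).
  apply: big1 => i _; rewrite !mxE.
  by case: ifP => [/(disjointFr dis) ->|_]; rewrite ?mulr0 ?mul0r.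
have cardP : (0 < #|P a|)%N.
  rewrite card_gt0; apply: contra nonempty => /eqP <-; exact: imset_f.
rewrite (eq_bigr (fun i => if i \in P a then (#|P a|%:R)^-1 else 0)); last first.
  move=> i _; rewrite !mxE; case: ifP => _; last by rewrite mul0r.
  by rewrite -invfM -expr2 sqr_sqrtr.
by rewrite -big_mkcond sumr_const -[LHS]mulr_natr mulVf // pnatr_eq0 -lt0n.
Qed.

Lemma invmx_orthonormal (R : realType) (m k : nat) (V : 'M[R]_(m + k, m))
    (W : 'M[R]_(m + k, k)) :
  V^T *m V = 1%:M -> orthonormal_complement V W ->
  row_mx V W \in unitmx /\ invmx (row_mx V W) = (row_mx V W)^T.
Proof.
move=> VV [WW WV]; set T := row_mx V W.
have VW : V^T *m W = 0 by rewrite -[LHS]trmxK trmx_mul trmxK WV trmx0.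
have TT : T^T *m T = 1%:M.
  by rewrite tr_row_mx mul_col_row VV VW WV WW -scalar_mx_block.
have [_ uT] := mulmx1_unit TT.
by split=> //; rewrite -[RHS]mulmx1 -(mulmxV uT) mulmxA TT mul1mx.
Qed.

Lemma conj_row_mx (R : realType) (n m k : nat) (V : 'M[R]_(n, m))
    (W : 'M[R]_(n, k)) (B : 'M[R]_n) :
  (row_mx V W)^T *m B *m row_mx V W =
  block_mx (V^T *m B *m V) (V^T *m B *m W) (W^T *m B *m V) (W^T *m B *m W).
Proof. by rewrite tr_row_mx mul_col_mx mul_col_row. Qed.

(** * The minimization problem *)

(* A partition into m nonempty clusters forces m <= n, so the number of nodes
   is written n = m + k, with k = n - m. *)
Theorem mainTheorem2 (R : realType) (m k : nat) (E : rel 'I_(m + k))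
    (A : 'M[R]_(m + k)) (P : 'I_m -> {set 'I_(m + k)})
    (Vbar : 'M[R]_(m + k, k)) (S : {set 'I_(m + k) * 'I_(m + k)}) :
  strongly_connected E ->
  weighted_adjacency E A ->
  (1 < m)%N ->
  is_partition P ->
  consecutive_blocks P ->
  let V : 'M[R]_(m + k, m) := char_mx R P in
  orthonormal_complement V Vbar ->
  let Abar : 'M[R]_(m + k) := inter_cluster_mx P A in
  let calH : 'M[R]_(m + k) -> Prop := sparsity_set S in
  let H : 'M[R]_(m + k) := pattern_mx calH in
  let T : 'M[R]_(m + k) := row_mx V Vbar in
  let Atilde : 'M[R]_(m + k) := invmx T *m Abar *m T in
  let A21 : 'M[R]_(k, m) := dlsubmx Atilde in
  ((exists Delta : 'M[R]_(m + k), is_minimizer V Vbar Abar calH Delta) <->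
   (exists (Lambda : 'M[R]_(k, m)) (X : 'M[R]_(m + k)),
      X = hadamard (Vbar *m Lambda *m V^T) H /\
      A21 = Vbar^T *m X *m V)) /\
  (forall (Lambda : 'M[R]_(k, m)) (X : 'M[R]_(m + k)),
     X = hadamard (Vbar *m Lambda *m V^T) H ->
     A21 = Vbar^T *m X *m V ->
     is_minimizer V Vbar Abar calH
       (T *m block_mx (- (V^T *m X *m V)) (- (V^T *m X *m Vbar))
                      (- A21) (- (Vbar^T *m X *m Vbar)) *m invmx T)).
Proof.
move=> _ _ _ partP _ V orthoW Abar calH H T Atilde A21.
have [uT invT] := invmx_orthonormal (char_mx_orthonormal R partP) orthoW.
have A21E : A21 = Vbar^T *m Abar *m V.
  by rewrite /A21 /Atilde invT conj_row_mx block_mxKdl.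
pose g : {linear 'M[R]_(m + k) -> 'M[R]_(k, m)} := masked_compression Vbar V H.
pose f (L : 'M[R]_(k, m)) := hadamard (Vbar *m L *m V^T) H.
have adj L D : frobenius_inner (f L) D = frobenius_inner L (g D).
  exact: adjoint_masked.
have gE D : calH D -> g D = Vbar^T *m D *m V.
  by move=> SD; rewrite /g /= /masked_compression (sparse_hadamard SD).
have feasibleP D : feasible V Vbar Abar calH D <-> g D = - A21 /\ calH D.
  rewrite /feasible mulmxDr mulmxDl -A21E addrC.
  split=> -[eqD SD]; split=> //.
    by rewrite gE //; apply/eqP; rewrite -addr_eq0 eqD.
  by rewrite -gE // eqD addNr.
have sparse_f L : calH (f L) by exact: hadamard_sparse.
have minimizer L X : X = f L -> A21 = Vbar^T *m X *m V ->
    is_minimizer V Vbar Abar calH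
      (T *m block_mx (- (V^T *m X *m V)) (- (V^T *m X *m Vbar))
                     (- A21) (- (Vbar^T *m X *m Vbar)) *m invmx T).
  move=> XE A21X; rewrite A21X -opp_block_mx -conj_row_mx -/T -invT.
  rewrite mulmxN mulNmx !mulmxA mulmxV // mul1mx -mulmxA mulmxV // mulmx1.
  have gX : g X = A21 by rewrite gE -?A21X // XE.
  have fN : f (- L) = - X.
    by apply/matrixP => i j; rewrite XE /f mulmxN mulNmx !mxE mulNr.
  rewrite -fN; split; first by apply/feasibleP; rewrite fN linearN /= -fN gX.
  move=> D /feasibleP[gD _]; apply: (least_norm_in_fibre (g := g)) => //.
  by rewrite gD fN linearN /= gX.
split=> //; split=> [[D [/feasibleP[gD SD] _]]|[L [X [XE A21X]]]]; last first.
  by eexists; exact: (minimizer L X XE A21X).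
have [L gL] := adjoint_range adj (- D).
exists L, (f L); split=> //.
by rewrite -gE // gL linearN /= gD opprK.
Qed.
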